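(* Let $N\subset M$ be a finite index inclusion of type $\mathrm{II}_1$ factors (not necessarily irreducible) and let $P,Q$ be intermediate subfactors of $N\subset M$, both different from $M$. Then the quadruple $(N,P,Q,M)$ is a co-commuting square if and only if $\beta^N_M(P,Q)=\frac{\pi}{2}$.
   Context: $E^M_A$ denotes the trace-preserving conditional expectation of $M$ onto $A\subseteq M$. A quadruple $(N,P,Q,M)$ of $\mathrm{II}_1$ factors with $N\subseteq P,Q\subseteq M$ is a commuting square if $E^M_PE^M_Q=E^M_QE^M_P=E^M_N$. $M_1=\langle M,e_1\rangle$ is the Jones basic construction of $N\subset M$ on $L^2(M)$, $e_1$ being the orthogonal projection of $L^2(M)$ onto $L^2(N)$, and $tr$ is the normalized trace of $M_1$. For an intermediate subfactor $P$, $e_P\in N'\cap M_1$ is the orthogonal projection of $L^2(M)$ onto $L^2(P)$, and $P_1=\langle M,e_P\rangle$ is the basic construction of $P\subset M$, so $M\subseteq P_1\subseteq M_1$. The quadruple $(N,P,Q,M)$ is a co-commuting square if $(M,Q_1,P_1,M_1)$ is a commuting square. For $P\neq N$ put $v_P=\frac{e_P-e_1}{\|e_P-e_1\|_2}$, where $\langle x,y\rangle=tr(y^*x)$ and $\|x\|_2=tr(x^*x)^{1/2}$. For $P,Q\ne N$ the angle is $\alpha^N_M(P,Q)=\cos^{-1}\langle v_P,v_Q\rangle$. For $P,Q\neq M$ the dual angle is $\beta^N_M(P,Q):=\alpha^M_{M_1}(P_1,Q_1)$, i.e. the same angle computed for the intermediate subfactors $P_1,Q_1$ of $M\subset M_1$.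 *)

(* Defs.v *)
(* The complex numbers are R[i], for R : realType. *)
From HB Require Import structures.
From mathcomp Require Import all_boot all_order all_algebra.
From mathcomp Require Import sesquilinear complex.
From mathcomp Require Import all_classical all_reals all_analysis.

Set Implicit Arguments.
Unset Strict Implicit.
Unset Printing Implicit Defensive.

Import Order.TTheory GRing.Theory Num.Theory.
Import numFieldNormedType.Exports.

Local Open Scope classical_set_scope.
Local Open Scope ring_scope.
Local Open Scope complex_scope.

(* The inner product is linear in its first argument. *)
Record hilbert (R : realType) := Hilbert {
  hilbert_sort :> completeNormedModType R[i];
  inner : {dot hilbert_sort for @Num.conj R[i]};
  inner_norm : forall u : hilbert_sort, `|u| ^+ 2 = inner u u }.

Arguments inner {R h}.

Section Operators.
Variables (R : realType) (H : hilbert R).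
Implicit Types (x y : H -> H) (S A D M N P Q : set (H -> H)) (t : (H -> H) -> R[i]).

Definition bounded_op : set (H -> H) := [set x | linear x /\ continuous x].

(* The unique such y when x is bounded; meaningless otherwise. *)
Definition adjoint x : H -> H :=
  get [set y : H -> H | forall u v : H, inner (x u) v = inner u (y v)].

Definition op_le x y : Prop := forall u : H, inner (x u) u <= inner (y u) u.

Definition op_pos x : Prop := forall u : H, 0 <= inner (x u) u.

(* Meaningful when W is a closed subspace. *)
Definition ortho_proj (W : set H) : H -> H :=
  get [set p : H -> H |
    forall u : H, W (p u) /\ forall w, W w -> inner (u - p u) w = 0].

Definition orbit_closure S (u : H) : set H := closure [set x u | x in S].

Definition commutant S : set (H -> H) :=
  [set x | bounded_op x /\ forall y, S y -> x \o y = y \o x].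

Definition von_neumann_algebra A : Prop :=
  [/\ A `<=` bounded_op,
      forall x, A x -> A (adjoint x) &
      commutant (commutant A) = A].

(* For self-adjoint S, by the double commutant theorem. *)
Definition vN_generated S : set (H -> H) := commutant (commutant S).

Definition factor A : Prop :=
  von_neumann_algebra A /\
  A `&` commutant A = [set x | exists a : R[i], x = fun u => a *: u].

Definition finite_dimensional A : Prop :=
  exists (n : nat) (b : 'I_n -> H -> H),
    forall x, A x -> exists a : 'I_n -> R[i], x = \sum_(i < n) a i *: b i.

(* Preservation of suprema of bounded increasing nets of positive elements. *)
Definition normal_functional A t : Prop :=
  forall D x,
    D !=set0 ->
    (forall d, D d -> A d /\ op_pos d) ->
    (forall d d', D d -> D d' ->
       exists2 e, D e & op_le d e /\ op_le d' e) ->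
    A x ->
    (forall d, D d -> op_le d x) ->
    (forall y, A y -> (forall d, D d -> op_le d y) -> op_le x y) ->
    forall c : R[i], (forall d, D d -> t d <= c) -> t x <= c.

(* Values of t outside A are irrelevant. *)
Definition normalized_trace A t : Prop :=
  [/\ forall (a : R[i]) x y, A x -> A y -> t (a *: x + y) = a * t x + t y,
      forall x y, A x -> A y -> t (x \o y) = t (y \o x),
      (forall x, A x -> op_pos x -> 0 <= t x) /\
      (forall x, A x -> op_pos x -> t x = 0 -> x = 0),
      normal_functional A t &
      t idfun = 1].

Definition II1_factor A : Prop :=
  [/\ factor A, ~ finite_dimensional A & exists t, normalized_trace A t].

(* The Murray-von Neumann coupling constant dim_A(H) of a II_1 factor A is
   t([A'u]) / t'([Au]) for any u != 0; it is +oo when A' carries no trace,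
   in which case the predicate below holds for no c. *)
Definition coupling_constant A (c : R) : Prop :=
  exists t t' (u : H),
    [/\ normalized_trace A t, normalized_trace (commutant A) t', u != 0 &
        c%:C = t (ortho_proj (orbit_closure (commutant A) u))
             / t' (ortho_proj (orbit_closure A u))].

Definition cond_exp M t A (E : (H -> H) -> (H -> H)) : Prop :=
  [/\ (forall x, M x -> A (E x)) /\ (forall a, A a -> E a = a),
      forall (c : R[i]) x y, M x -> M y -> E (c *: x + y) = c *: E x + E y,
      forall a x b, A a -> M x -> A b -> E (a \o x \o b) = a \o E x \o b,
      forall x, M x -> op_pos x -> op_pos (E x) &
      forall x, M x -> t (E x) = t x].

(* E A stands for the trace-preserving conditional expectation of M onto A. *)
Definition commuting_square (E : set (H -> H) -> (H -> H) -> (H -> H))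
    N P Q M : Prop :=
  forall x, M x -> E P (E Q x) = E N x /\ E Q (E P x) = E N x.

Definition inner2 t x y : R[i] := t (adjoint y \o x).

Definition norm2 t x : R[i] := sqrtC (inner2 t x x).

End Operators.

(* GNS triple of (M, tr): L^2(M) with its left action of M and the trace
   vector, determined up to unitary equivalence.  The values of lmul outside M
   are irrelevant. *)
Record L2_space (R : realType) (K : hilbert R) (M : set (K -> K))
    (tr : (K -> K) -> R[i]) := L2Space {
  L2_hilbert :> hilbert R;
  lmul : (K -> K) -> (L2_hilbert -> L2_hilbert);
  trace_vector : L2_hilbert;
  lmul_bounded : forall x, M x -> bounded_op (lmul x);
  lmul1 : lmul idfun = idfun;
  lmul_linear : forall (a : R[i]) x y, M x -> M y ->
    lmul (a *: x + y) = a *: lmul x + lmul y;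
  lmulM : forall x y, M x -> M y -> lmul (x \o y) = lmul x \o lmul y;
  lmul_adjoint : forall x, M x -> lmul (adjoint x) = adjoint (lmul x);
  trace_vectorE : forall x, M x ->
    inner (lmul x trace_vector) trace_vector = tr x;
  trace_vector_cyclic : orbit_closure (lmul @` M) trace_vector = setT }.

Section BasicConstruction.
Variables (R : realType) (K : hilbert R) (M : set (K -> K)).
Variables (tr : (K -> K) -> R[i]) (L : L2_space M tr).
Implicit Types (N P Q A : set (K -> K)) (t : (L -> L) -> R[i]).

(* The copy on L^2(M) of A, a subset of M. *)
Definition limage A : set (L -> L) := @lmul _ _ _ _ L @` A.

(* e_A, the projection of L^2(M) onto L^2(A). *)
Definition jones_proj A : L -> L :=
  ortho_proj (orbit_closure (limage A) (trace_vector L)).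

(* <M, e_A> *)
Definition basic_construction A : set (L -> L) :=
  vN_generated (limage M `|` [set jones_proj A]).

(* [M : N] = dim_N L^2(M) *)
Definition jones_index N (c : R) : Prop := coupling_constant (limage N) c.

Definition finite_index N : Prop := exists c, jones_index N c.

(* In the next two definitions t is the normalized trace of <M, e_N>. *)
Definition unit_proj t N P : L -> L :=
  (norm2 t (jones_proj P - jones_proj N))^-1 *: (jones_proj P - jones_proj N).

(* The inner product is real, so taking its real part only changes its type.
   Meaningful for P, Q != N. *)
Definition angle t N P Q : R :=
  acos (complex.Re (inner2 t (unit_proj t N P) (unit_proj t N Q))).

(* E A stands for the conditional expectation of M_1 = <M, e_N> onto A. *)
Definition co_commuting_square (E : set (L -> L) -> (L -> L) -> (L -> L))
    N P Q : Prop :=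
  commuting_square E (limage M) (basic_construction Q) (basic_construction P)
    (basic_construction N).

End BasicConstruction.

Arguments limage {R K M tr}.
Arguments jones_proj {R K M tr}.
Arguments basic_construction {R K M tr}.
Arguments jones_index {R K M tr}.
Arguments finite_index {R K M tr}.
Arguments co_commuting_square {R K M tr}.


(* tr1 is the normalized trace of M_1 = <M, e_N>, L1 is L^2(M_1), and t is the
   normalized trace of the basic construction of M in M_1. *)
Definition dual_angle (R : realType) (K : hilbert R) (M : set (K -> K))
    (tr : (K -> K) -> R[i]) (L : L2_space M tr) (N : set (K -> K))
    (tr1 : (L -> L) -> R[i]) (L1 : L2_space (basic_construction L N) tr1)
    (t : (L1 -> L1) -> R[i]) (P Q : set (K -> K)) : R :=
  angle t (limage L M) (basic_construction L P) (basic_construction L Q).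

(* Main.v *)
(* For P1 in M1, the projection e_P1 of L^2(M1) restricts on M1 Omega to the
   conditional expectation, and Omega is separating, so (M, Q1, P1, M1) is a
   commuting square iff e_Q1 e_P1 = e_M.  As e_M lies below both projections,
   f = e_P1 - e_M and g = e_Q1 - e_M are projections with
   g f = e_Q1 e_P1 - e_M, and tr (g f) = tr ((g f)^* (g f)) vanishes iff g f = 0
   by faithfulness of the trace.  When f or g is 0 the unit projection is
   0^-1 *: 0 = 0, and the equivalence persists because acos 0 = pi / 2. *)

From HB Require Import structures.
Require Import Defs.
From mathcomp Require Import all_boot all_order all_algebra.
From mathcomp Require Import lra.
From mathcomp Require Import sesquilinear complex.
From mathcomp Require Import all_classical all_reals all_analysis.

Set Implicit Arguments.
Unset Strict Implicit.
Unset Printing Implicit Defensive.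

Import Order.TTheory GRing.Theory Num.Theory.
Import numFieldNormedType.Exports.

Local Open Scope classical_set_scope.
Local Open Scope ring_scope.
Local Open Scope complex_scope.

(** [adjoint] and [ortho_proj] are picked by [get], so their defining equations become available
    only once a witness is produced; hence the projection theorem and Riesz representation come
    before any operator algebra. The trace [tr2] is controlled only on <M_1, e_M>, so e_P1 and e_Q1
    have to be placed there although neither is among the generators. That an intermediate Jones
    projection lies in the basic construction of the smaller algebra settles this, at two levels of
    the tower: for N, P, M on L^2(M) it gives the inclusion of P_1 in M_1, and for M, P_1, M_1 on
    L^2(M_1) it puts e_P1 - e_M in the algebra carrying [tr2]. Finally, passing from the angle pi /
    2 to a vanishing cosine inverts [acos], which requires the cosine to lie in [-1, 1]; this bound
    comes from tr (g f) <= tr f and tr (g f) <= tr g. *)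

Section LinearContinuity.
Variables (R : realType) (V W : normedModType R[i]).

Lemma linear_fun0 (f : V -> W) : linear f -> f 0 = 0.
Proof. by move=> /(_ (-1) 0 0); rewrite scaler0 addr0 scaleN1r addNr. Qed.

Lemma linear_funB (f : V -> W) u v : linear f -> f (u - v) = f u - f v.
Proof.
by move=> /(_ (-1) v u); rewrite !scaleN1r => E; rewrite [u - v]addrC E addrC.
Qed.

Lemma bounded_continuous (f : V -> W) (r : R[i]) : linear f -> 0 <= r ->
  (forall x, `|f x| <= r * `|x|) -> continuous f.
Proof.
move=> fl r0 fr; pose F : {linear V -> W} :=
  HB.pack f (GRing.isLinear.Build R[i] V W *:%R f fl).
apply: (bounded_linear_continuous (f := F)); apply/bounded_funP => s.
exists (r * s) => x xs.
by apply: le_trans (fr x) _; rewrite ler_wpM2l.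
Qed.

Lemma continuous_bounded (f : V -> W) : linear f -> continuous f ->
  exists2 r : R[i], 0 <= r & forall x, `|f x| <= r * `|x|.
Proof.
move=> fl fc; pose F : {linear V -> W} :=
  HB.pack f (GRing.isLinear.Build R[i] V W *:%R f fl).
have /linear_boundedP : bounded_near F (nbhs 0).
  exact/linear_bounded_continuous.
by move=> /pinfty_ex_gt0[r /ltW r0 Fr]; exists r.
Qed.

Lemma closure_preimage (f : V -> W) (A : set V) (B : set W) :
  continuous f -> closed B -> A `<=` f @^-1` B -> closure A `<=` f @^-1` B.
Proof.
move=> /continuous_closedP fc /fc /closure_id fB AB.
by rewrite fB; exact: closureS.
Qed.

(** The difference of f and g is continuous and {0} is closed. This extends identities checked on a
    dense orbit to the whole space. *)
Lemma closure_eq (f g : V -> W) (A : set V) : continuous f -> continuous g ->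
  (forall x, A x -> f x = g x) -> forall x, closure A x -> f x = g x.
Proof.
move=> fc gc Afg x Ax; apply/subr0_eq.
apply: (@closure_preimage (f \- g) A [set 0]) Ax.
- by move=> y; apply: cvgB; [exact: fc|exact: gc].
- exact: accessible_closed_set1 (hausdorff_accessible (@norm_hausdorff _ _)) _.
- by move=> y Ay /=; rewrite Afg// subrr.
Qed.

End LinearContinuity.

(** * Inner product geometry: Cauchy-Schwarz and the parallelogram law *)

Section InnerProduct.
Variables (R : realType) (H : hilbert R).
Implicit Types (u v w : H) (a : R[i]) (W : set H).

Lemma innerC u v : inner u v = Num.conj (inner v u).
Proof. by rewrite hermC /= expr0 mul1r. Qed.

Lemma innerDl u v w : inner (u + v) w = inner u w + inner v w.
Proof. exact: linearDl. Qed.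

Lemma innerBl u v w : inner (u - v) w = inner u w - inner v w.
Proof. exact: linearBl. Qed.

Lemma innerBr u v w : inner w (u - v) = inner w u - inner w v.
Proof. exact: linearBr. Qed.

Lemma innerZl a u w : inner (a *: u) w = a * inner u w.
Proof. exact: linearZl_LR. Qed.

Lemma innerZr a u w : inner w (a *: u) = Num.conj a * inner w u.
Proof. exact: linearZr_LR. Qed.

Lemma inner0l w : inner 0 w = 0.
Proof. exact: linear0l. Qed.

Lemma inner0r w : inner w 0 = 0.
Proof. exact: linear0r. Qed.

Lemma inner_ge0 u : 0 <= inner u u.
Proof. by rewrite -inner_norm exprn_ge0. Qed.

Lemma inner_eq0 u : inner u u = 0 -> u = 0.
Proof. by move=> /eqP; rewrite -inner_norm sqrf_eq0 normr_eq0 => /eqP. Qed.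

Lemma inner_eq0C u v : inner u v = 0 -> inner v u = 0.
Proof. by move=> uv; rewrite innerC uv conjC0. Qed.

Lemma inner_inj u v : (forall w, inner u w = inner v w) -> u = v.
Proof.
by move=> uv; apply/subr0_eq/inner_eq0; rewrite innerBl uv subrr.
Qed.

(* Pythagoras for u = (u - c v) + c v, where c v is the projection of u on
   the line through v. *)
Lemma norm_sub_line u v : v != 0 ->
  `|u - (inner u v / inner v v) *: v| ^+ 2 =
  `|u| ^+ 2 - `|inner u v| ^+ 2 / `|v| ^+ 2.
Proof.
move=> v0; have vv0 : inner v v != 0.
  by apply: contra_neq v0 => /inner_eq0.
rewrite !inner_norm; set c := _ / _.
have ov : inner (u - c *: v) v = 0.
  by rewrite innerBl innerZl divfK ?subrr.
rewrite innerBr innerZr ov mulr0 subr0 innerBl innerZl (innerC v u).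
by rewrite normCK /c mulrAC.
Qed.

Lemma cauchy_schwarz u v : `|inner u v| <= `|u| * `|v|.
Proof.
have [->|v0] := eqVneq v 0; first by rewrite inner0r !normr0 mulr0.
rewrite -ler_sqr ?nnegrE ?mulr_ge0// exprMn.
have : 0 <= `|u - (inner u v / inner v v) *: v| ^+ 2 by rewrite exprn_ge0.
by rewrite norm_sub_line// subr_ge0 ler_pdivrMr ?exprn_gt0 ?normr_gt0.
Qed.

Lemma parallelogram u v :
  `|u + v| ^+ 2 + `|u - v| ^+ 2 = (`|u| ^+ 2 + `|v| ^+ 2) *+ 2.
Proof.
rewrite !inner_norm hnormD hnormB /=.
by rewrite addrACA subrr addr0 mulr2n.
Qed.

Lemma innerl_continuous v : continuous (fun u => inner u v : R[i]^o).
Proof.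
apply: (bounded_continuous (r := `|v|)) => [a x y||x].
- by rewrite innerDl innerZl.
- exact: normr_ge0.
- by rewrite mulrC cauchy_schwarz.
Qed.

Lemma inner_closure_eq0 W v : (forall w, W w -> inner w v = 0) ->
  forall w, closure W w -> inner w v = 0.
Proof.
move=> Wv; apply: (@closure_eq R H R[i]^o (fun u => inner u v) (fun=> 0)) => //.
- exact: innerl_continuous.
- exact: cst_continuous.
Qed.

End InnerProduct.

(** * The projection theorem for closed subspaces *)

Section OrthogonalProjection.
Variables (R : realType) (H : hilbert R).
Implicit Types (u v w : H) (W : set H).

Definition linear_subspace W :=
  W 0 /\ forall (a : R[i]) u v, W u -> W v -> W (a *: u + v).

Lemma closure_linear_subspace W :
  linear_subspace W -> linear_subspace (closure W).
Proof.
move=> [W0 WD]; split; first exact: subset_closure.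
move=> a u v Wu Wv.
have au : continuous (fun x : H => a *: x).
  exact: scaler_continuous.
have cD x : continuous (fun y : H => x + y).
  by move=> y; apply: cvgD; [exact: cvg_cst|exact: cvg_id].
(* The two variables enter the closure one at a time: v with [a *: u] fixed, then u with a point y
   of W fixed. *)
apply: (closure_preimage (cD (a *: u)) (@closed_closure _ W) _ Wv) => y Wy /=.
have cT : continuous (fun x : H => a *: x + y).
  by move=> x; apply: cvgD; [exact: au|exact: cvg_cst].
apply: (closure_preimage cT (@closed_closure _ W) _ Wu) => x Wx /=.
by apply: subset_closure; exact: WD.
Qed.

(** Norms take values in R[i]; the real part is taken so that infima in R can be used. *)
Let dist2 u v : R := complex.Re (`|u - v| ^+ 2).

Let dist2E u v : (dist2 u v)%:C = `|u - v| ^+ 2.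
Proof. by rewrite RRe_real// realE exprn_ge0. Qed.

(** Near-minimality is expressed by comparison with every point of W, so the infimum itself never
    appears. For e > 0 these sets form the filter base that replaces a minimizing sequence. *)
Let near_min W u (e : R) := [set w | W w /\
  forall x, W x -> dist2 u w <= dist2 u x + e].

Let near_min_neq0 W u (e : R) : W !=set0 -> 0 < e -> near_min W u e !=set0.
Proof.
move=> [w Ww] e0; pose D := [set dist2 u x | x in W].
have hD : has_inf D.
  split; first by exists (dist2 u w), w.
  by exists 0 => _ [x _ <-]; rewrite -ler0c dist2E exprn_ge0.
have [_ [x Wx <-] xe] := inf_adherent e0 hD.
exists x; split=> // y Wy; apply: (le_trans (ltW xe)).
by rewrite lerD2r; apply: ge_inf; [case: hD|exists y].
Qed.

(* By the parallelogram law, applied with the midpoint of w and x. *)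
Let near_min_diam W u (e : R) w x : linear_subspace W ->
  near_min W u e w -> near_min W u e x -> `|w - x| ^+ 2 <= (e *+ 4)%:C.
Proof.
move=> [W0 WD] [Ww mw] [Wx mx].
pose m := 2^-1 *: (w + x).
have Wm : W m.
  have Wwx : W (w + x) by rewrite -[w]scale1r; exact: WD.
  by rewrite -[m]addr0; exact: WD.
have Em : (u - w) + (u - x) = 2 *: (u - m).
  rewrite scalerBr scalerA divff// scale1r scaler_nat mulr2n.
  by rewrite addrACA -opprD.
have Ex : (u - w) - (u - x) = x - w by rewrite opprB addrC addrA subrK.
have E : 4 * dist2 u m + dist2 x w = (dist2 u w + dist2 u x) *+ 2.
  apply: complexI; rewrite rmorphMn/= !rmorphD rmorphM/= !dist2E.
  rewrite -parallelogram Em Ex normrZ exprMn rmorph_nat normr_nat.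
  by rewrite -natrX.
rewrite distrC -dist2E lecR; have := mw _ Wm; have := mx _ Wm.
lra.
Qed.

(** Moving w along x to the best point of that line lowers the squared distance by |<u - w, x>|^2 /
    |x|^2, and near-minimality allows a gain of at most e. *)
Let near_min_ortho W u (e : R) w x : linear_subspace W -> 0 <= e ->
  near_min W u e w -> W x -> `|inner (u - w) x| ^+ 2 <= e%:C * `|x| ^+ 2.
Proof.
move=> [W0 WD] e0 [Ww mw] Wx.
have [->|x0] := eqVneq x 0.
  by rewrite inner0r !normr0 expr0n mulr0.
rewrite -ler_pdivrMr ?exprn_gt0 ?normr_gt0//.
set c := inner (u - w) x / inner x x.
have := mw (c *: x + w) (WD _ _ _ Wx Ww); rewrite -lecR rmorphD/= !dist2E.
rewrite opprD addrA addrAC norm_sub_line//.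
by rewrite -lerBlDl opprB addrCA subrr addr0.
Qed.

(** The near-minimizers generate a Cauchy filter, whose limit p lies in the closed set W.
    Orthogonality is obtained directly as a limit of [near_min_ortho], without passing through
    minimality of p. *)
Lemma projection_exists W u : linear_subspace W -> closed W ->
  exists2 p, W p & forall w, W w -> inner (u - p) w = 0.
Proof.
move=> sW cW; have WD := sW.2.
pose F := filter_from [set e : R | 0 < e] (near_min W u).
have sub_near e e' : e <= e' -> near_min W u e `<=` near_min W u e'.
  move=> ee' w [Ww mw]; split=> // x Wx.
  by apply: le_trans (mw x Wx) _; rewrite lerD2l.
have FF : ProperFilter F.
  apply: filter_from_proper; last first.
    by move=> e /= e0; apply: near_min_neq0 => //; exists 0; exact: sW.1.
  apply: filter_from_filter; first by exists 1 => /=.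
  move=> e e' /= e0 e'0; exists (Order.min e e').
    by rewrite /= lt_min e0.
  by rewrite subsetI; split; apply: sub_near; rewrite ge_min lexx ?orbT.
have Fc : cvg F.
  apply/cauchy_cvgP/cauchy_exP => e e0.
  have [r Er] : exists r : R, e = r%:C.
    by apply/complex_realP; exact: gtr0_real.
  have r0 : 0 < r by rewrite -ltcR -Er.
  (* By [near_min_diam], tolerance s bounds squared distances by 4 s = r^2 / 2 < r^2. *)
  pose s := r ^+ 2 / 8.
  have s0 : 0 < s by rewrite divr_gt0 ?exprn_gt0.
  have [w wm] : near_min W u s !=set0.
    by apply: near_min_neq0 => //; exists 0; exact: sW.1.
  exists w, s => //= x xm.
  rewrite -ball_normE /= -ltr_sqr ?nnegrE ?normr_ge0 ?ltW//.
  apply: le_lt_trans (near_min_diam sW wm xm) _.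
  rewrite Er -rmorphXn /= ltcR /s.
  have : 0 < r ^+ 2 by rewrite exprn_gt0.
  lra.
exists (lim F).
  apply: (@closed_cvg _ _ F _ id W cW _ (lim F) Fc).
  by exists 1 => //= w [].
move=> w Ww.
have cvF : inner (u - s) w @[s --> F] --> (inner (u - lim F) w : R[i]^o).
  apply: (@cvg_comp _ _ _ (fun s => u - s) (fun x => inner x w : R[i]^o) F
    (nbhs (u - lim F))); last exact: innerl_continuous.
  by apply: cvgB; [exact: cvg_cst|exact: Fc].
have cv0 : inner (u - s) w @[s --> F] --> (0 : R[i]^o).
  apply/cvgr0Pnorm_le => e e0.
  have [r Er] : exists r : R, e = r%:C.
    by apply/complex_realP; exact: gtr0_real.
  have r0 : 0 < r by rewrite -ltcR -Er.
  have w0 : 0 <= dist2 w 0 by rewrite -ler0c dist2E exprn_ge0.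
  (* Chosen so that s |w|^2 <= r^2; the added 1 covers w = 0. *)
  pose s := r ^+ 2 / (dist2 w 0 + 1).
  have s0 : 0 < s by rewrite divr_gt0 ?exprn_gt0// ltr_wpDl.
  exists s => //= x xm.
  rewrite -ler_sqr ?nnegrE ?normr_ge0 ?(ltW e0)//.
  apply: le_trans (near_min_ortho sW (ltW s0) xm Ww) _.
  rewrite -[w in X in _ * X]subr0 -dist2E Er -rmorphXn /= -rmorphM lecR /s.
  rewrite mulrAC ler_pdivrMr ?ltr_wpDl// mulrDr mulr1 lerDl.
  by rewrite exprn_ge0// ltW.
exact: (cvg_unique (@norm_hausdorff _ R[i]^o) cvF cv0).
Qed.

End OrthogonalProjection.

(** * Orthogonal projections as bounded operators *)

Section OrthoProj.
Variables (R : realType) (H : hilbert R) (W : set H).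
Hypotheses (sW : linear_subspace W) (cW : closed W).
Local Notation e := (ortho_proj W).

Lemma ortho_projP u : W (e u) /\ forall w, W w -> inner (u - e u) w = 0.
Proof.
have PE v : exists p, W p /\ forall w, W w -> inner (v - p) w = 0.
  by have [p] := projection_exists v sW cW; exists p.
(* [get] asks for a single function, so the pointwise projections are assembled by choice. *)
have [f Wf] := choice PE.
exact: (@getPex _ [set p : H -> H | forall u,
  W (p u) /\ forall w, W w -> inner (u - p u) w = 0] (ex_intro _ f Wf)).
Qed.

Lemma ortho_proj_in u : W (e u).
Proof. by have [] := ortho_projP u. Qed.

Lemma ortho_proj_sub u w : W w -> inner (u - e u) w = 0.
Proof. by have [_] := ortho_projP u; apply. Qed.

Lemma ortho_proj_uniq u p :
  W p -> (forall w, W w -> inner (u - p) w = 0) -> e u = p.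
Proof.
move=> Wp op; apply/subr0_eq/inner_eq0.
have We : W (e u - p).
  by rewrite addrC -scaleN1r; apply: sW.2 => //; exact: ortho_proj_in.
have := op _ We; have := ortho_proj_sub u We.
rewrite !(innerBl u) (innerBl (e u)) => /subr0_eq <- /subr0_eq <-.
by rewrite subrr.
Qed.

Lemma ortho_proj_id w : W w -> e w = w.
Proof.
by move=> Ww; apply: ortho_proj_uniq => // x _; rewrite subrr inner0l.
Qed.

Lemma ortho_proj_linear : linear e.
Proof.
move=> a u v; apply: ortho_proj_uniq => [|w Ww].
  by apply: sW.2; exact: ortho_proj_in.
rewrite opprD addrACA -scalerBr innerDl innerZl.
by rewrite !ortho_proj_sub// mulr0 addr0.
Qed.

Lemma ortho_proj_self u v : inner (e u) v = inner u (e v).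
Proof.
have : inner (e u) (v - e v) = 0.
  by apply: inner_eq0C; apply: ortho_proj_sub; exact: ortho_proj_in.
have := ortho_proj_sub u (ortho_proj_in v).
rewrite innerBl innerBr => /subr0_eq -> /subr0_eq //.
Qed.

(** Since |e u|^2 = <u, e u>, Cauchy-Schwarz gives |e u| <= |u|. *)
Lemma ortho_proj_bounded : bounded_op e.
Proof.
split; first exact: ortho_proj_linear.
apply: (bounded_continuous (r := 1)) => // [|u]; first exact: ortho_proj_linear.
rewrite mul1r; have [->|eu0] := eqVneq (e u) 0; first by rewrite normr0.
rewrite -(ler_pM2r (_ : 0 < `|e u|)) ?normr_gt0//.
apply: le_trans (cauchy_schwarz u (e u)).
rewrite -expr2 inner_norm ortho_proj_self (ortho_proj_id (ortho_proj_in u)).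
rewrite ger0_norm// -(ortho_proj_id (ortho_proj_in u)) -ortho_proj_self.
exact: inner_ge0.
Qed.

End OrthoProj.

Lemma ortho_proj_le (R : realType) (H : hilbert R) (V W : set H) (u : H) :
  linear_subspace V -> closed V -> linear_subspace W -> closed W -> V `<=` W ->
  ortho_proj V (ortho_proj W u) = ortho_proj V u.
Proof.
move=> sV cV sW cW VW; apply: ortho_proj_uniq => // [|w Vw].
  exact: ortho_proj_in.
rewrite -(subrK u (ortho_proj W u)) -addrA innerDl.
rewrite ortho_proj_sub// addr0 -opprB -scaleN1r innerZl.
by rewrite ortho_proj_sub ?mulr0//; exact: VW.
Qed.

(** * Riesz representation and adjoints *)

Section Adjoint.
Variables (R : realType) (H : hilbert R).
Implicit Types (x y : H -> H) (u v w : H).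

Lemma riesz (f : H -> R[i]^o) : linear f -> continuous f ->
  exists v, forall u, f u = inner u v.
Proof.
move=> fl fc; pose W := [set u | f u = 0].
have f0 := linear_fun0 fl.
have fD u v a : f (u - a *: v) = f u - a * f v.
  by rewrite addrC -scaleNr fl scaleNr addrC.
have sW : linear_subspace W.
  by split=> // a u v Wu Wv; rewrite /W /= fl Wu Wv scaler0 addr0.
have cW : closed W.
  apply: (continuous_closedP _).1 fc [set 0] _.
  exact: accessible_closed_set1 (hausdorff_accessible (@norm_hausdorff _ _)) _.
have [WT|/existsNP[z0 Wz0]] := pselect (forall u, W u).
  by exists 0 => u; rewrite inner0r; exact: WT.
pose z := z0 - ortho_proj W z0.
have fz : f z != 0.
  apply/eqP; rewrite /z -[ortho_proj _ _]scale1r fD mul1r.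
  by rewrite (ortho_proj_in sW cW z0) subr0.
(* z is orthogonal to the kernel of f, and u - (f u / f z) z lies in that kernel, so <u, z> = (f u /
   f z) <z, z>. The conjugate compensates for conjugate-linearity in the second argument. *)
exists (Num.conj (f z / inner z z) *: z) => u; rewrite innerZr conjCK.
have zz : inner z z != 0.
  by apply: contra_neq fz => /inner_eq0 ->.
have Wu : W (u - (f u / f z) *: z) by rewrite /W /= fD divfK// subrr.
have := inner_eq0C (ortho_proj_sub sW cW z0 Wu).
rewrite innerBl innerZl => /subr0_eq ->.
by rewrite mulrC -mulrA [X in _ = _ * X]mulrCA divff// mulr1 divfK.
Qed.

Lemma adjointP x : bounded_op x ->
  forall u v, inner (x u) v = inner u (adjoint x v).
Proof.
move=> [xl xc].
have yE v : exists w : H, forall u, inner (x u) v = inner u w.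
  apply: (riesz (f := fun u => inner (x u) v)) => [a u w|u].
    by rewrite xl innerDl innerZl.
  exact: (@continuous_comp _ _ R[i]^o x (fun w => inner w v) u (xc u)
    (@innerl_continuous _ _ v (x u))).
have [y xy] := choice yE.
exact: (@getPex _ [set y : H -> H | forall u v, inner (x u) v = inner u (y v)]
  (ex_intro _ y (fun u v => xy v u))).
Qed.

Lemma adjointPC x : bounded_op x ->
  forall u v, inner (adjoint x u) v = inner u (x v).
Proof. by move=> xb u v; rewrite innerC -adjointP// -innerC. Qed.

(** The hypothesis itself is the witness that [get] requires, and nondegeneracy makes it the only
    one. Concrete adjoints are computed through this lemma. *)
Lemma adjoint_uniq x y :
  (forall u v, inner (x u) v = inner u (y v)) -> adjoint x = y.
Proof.
move=> xy; have := @getPex _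
  [set y : H -> H | forall u v, inner (x u) v = inner u (y v)]
  (ex_intro _ y xy).
move=> /= xA; apply/funext => v; apply: inner_inj => w.
by rewrite innerC -xA xy -innerC.
Qed.

(** A bound r of x serves again: |x^* u|^2 = <u, x x^* u> <= |u| r |x^* u|. *)
Lemma adjoint_bounded x : bounded_op x -> bounded_op (adjoint x).
Proof.
move=> xb; have yl : linear (adjoint x).
  move=> a u v; apply: inner_inj => w.
  by rewrite innerDl innerZl !adjointPC// innerDl innerZl.
split=> //; have [xl xc] := xb; have [r r0 xr] := continuous_bounded xl xc.
apply: (bounded_continuous yl r0) => u.
set y := adjoint x.
have [->|yu0] := eqVneq (y u) 0; first by rewrite normr0 mulr_ge0.
rewrite -(ler_pM2r (_ : 0 < `|y u|)) ?normr_gt0//.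
rewrite -expr2 inner_norm adjointPC// -[inner _ _]ger0_norm; last first.
  by rewrite -adjointPC// inner_ge0.
apply: le_trans (cauchy_schwarz _ _) _.
by rewrite mulrAC mulrC ler_wpM2r.
Qed.

Lemma adjointZ (a : R[i]) x : bounded_op x ->
  adjoint (a *: x) = Num.conj a *: adjoint x.
Proof.
move=> xb; apply: adjoint_uniq => u v.
change (inner (a *: x u) v = inner u (Num.conj a *: adjoint x v)).
by rewrite innerZl innerZr conjCK adjointP.
Qed.

Lemma adjointB x y : bounded_op x -> bounded_op y ->
  adjoint (x - y) = adjoint x - adjoint y.
Proof.
move=> xb yb; apply: adjoint_uniq => u v.
change (inner (x u - y u) v = inner u (adjoint x v - adjoint y v)).
by rewrite innerBl innerBr !adjointP.
Qed.

Lemma adjointM x y : bounded_op x -> bounded_op y ->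
  adjoint (x \o y) = adjoint y \o adjoint x.
Proof. by move=> xb yb; apply: adjoint_uniq => u v /=; rewrite !adjointP. Qed.

End Adjoint.

(** * Star algebras, commutants and double commutants *)

Section StarAlgebra.
Variables (R : realType) (H : hilbert R).
Implicit Types (x y : H -> H) (A S : set (H -> H)).

(** The algebraic structure shared by the given factors, their images on L^2(M) and the basic
    constructions; it lets the same lemmas apply at each level of the tower. *)
Record star_algebra A : Prop := StarAlgebra {
  star_algebra_bounded : A `<=` @bounded_op R H;
  star_algebra1 : A idfun;
  star_algebraD : forall (a : R[i]) x y, A x -> A y -> A (a *: x + y);
  star_algebraM : forall x y, A x -> A y -> A (x \o y);
  star_algebra_adjoint : forall x, A x -> A (adjoint x) }.

Lemma star_algebra0 A : star_algebra A -> A 0.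
Proof.
move=> sA; have A1 := star_algebra1 sA.
by have := star_algebraD sA (-1) A1 A1; rewrite scaleN1r addNr.
Qed.

Lemma star_algebraB A x y : star_algebra A -> A x -> A y -> A (x - y).
Proof.
by move=> sA Ax Ay; rewrite addrC -scaleN1r; exact: star_algebraD.
Qed.

Lemma bounded_opD (a : R[i]) x y :
  bounded_op x -> bounded_op y -> bounded_op (a *: x + y).
Proof.
move=> [xl xc] [yl yc]; split=> [b u v|u].
  change (a *: x (b *: u + v) + y (b *: u + v) =
    b *: (a *: x u + y u) + (a *: x v + y v)).
  rewrite xl yl !scalerDr !scalerA (mulrC a) -!addrA; congr (_ + _).
  by rewrite addrCA.
apply: (@cvgD _ _ _ _ _ (fun u => a *: x u) y); last exact: yc.
by apply: cvgZr; exact: xc.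
Qed.

Lemma bounded_op1 : bounded_op (idfun : H -> H).
Proof. by split=> // u; exact: cvg_id. Qed.

Lemma bounded_opM x y : bounded_op x -> bounded_op y -> bounded_op (x \o y).
Proof.
move=> [xl xc] [yl yc]; split=> [b u v|u]; first by rewrite /= yl xl.
exact: continuous_comp (yc u) (xc (y u)).
Qed.

(** For the adjoint: x commutes with z^*, which is again in S, so x^* commutes with z. *)
Lemma commutant_star_algebra S : S `<=` @bounded_op R H ->
  (forall x, S x -> S (adjoint x)) -> star_algebra (commutant S).
Proof.
move=> Sb Sadj; split.
- by move=> x [].
- by split; first exact: bounded_op1.
- move=> a x y [xb xS] [yb yS]; split; first exact: bounded_opD.
  move=> z Sz; have [zl _] := Sb _ Sz.
  apply/funext => u; have /= xz := congr1 (@^~ u) (xS _ Sz).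
  have /= yz := congr1 (@^~ u) (yS _ Sz).
  change (a *: x (z u) + y (z u) = z (a *: x u + y u)).
  by rewrite zl xz yz.
- move=> x y [xb xS] [yb yS]; split; first exact: bounded_opM.
  by move=> z Sz; rewrite -compA yS// compA xS.
- move=> x [xb xS]; split; first exact: adjoint_bounded.
  move=> z Sz; apply/funext => u /=; apply: inner_inj => w.
  rewrite adjointPC//; apply/esym.
  rewrite (adjointP (Sb _ Sz)) adjointPC// (adjointP (Sb _ Sz)).
  by have /= -> := congr1 (@^~ w) (xS _ (Sadj _ Sz)).
Qed.

Lemma vN_generated_star_algebra S : S `<=` @bounded_op R H ->
  (forall x, S x -> S (adjoint x)) -> star_algebra (vN_generated S).
Proof.
move=> Sb Sadj; have sS := commutant_star_algebra Sb Sadj.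
by apply: commutant_star_algebra; case: sS.
Qed.

Lemma von_neumann_star_algebra A : von_neumann_algebra A -> star_algebra A.
Proof. by case=> Ab Aadj <-; exact: vN_generated_star_algebra. Qed.

Lemma sub_vN_generated S : S `<=` @bounded_op R H -> S `<=` vN_generated S.
Proof.
by move=> Sb x Sx; split; [exact: Sb|move=> y [_ ->]].
Qed.

(** T inside S'' makes S' part of T', whence T'' is inside S''. Inclusions of basic constructions
    thus reduce to generators. *)
Lemma vN_generated_min S T : T `<=` vN_generated S ->
  vN_generated T `<=` vN_generated S.
Proof.
move=> TS x [xb xT]; split=> // y [yb yS]; apply: xT; split=> // z /TS[_ zS].
by rewrite zS//; split.
Qed.

Lemma adjoint_ortho_proj (W : set H) : linear_subspace W -> closed W ->
  adjoint (ortho_proj W) = ortho_proj W.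
Proof. by move=> sW cW; apply: adjoint_uniq => u v; exact: ortho_proj_self. Qed.

Lemma op_pos_adjoint_mul x : bounded_op x -> op_pos (adjoint x \o x).
Proof. by move=> xb u /=; rewrite adjointPC// inner_ge0. Qed.

Lemma adjoint_mul_eq0 x : bounded_op x -> adjoint x \o x = 0 -> x = 0.
Proof.
move=> xb xx; apply/funext => u; apply: inner_eq0.
by rewrite -adjointPC// [adjoint x _](congr1 (@^~ u) xx) inner0l.
Qed.

End StarAlgebra.

(** * Jones projections and basic constructions on L^2(M) *)

Section L2Space.
Variables (R : realType) (K : hilbert R) (M : set (K -> K)).
Variables (tr : (K -> K) -> R[i]) (L : L2_space M tr).
Hypothesis sM : star_algebra M.
Implicit Types (x y a : K -> K) (A B : set (K -> K)).

Local Notation lam := (@lmul R K M tr L).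
Local Notation Omega := (trace_vector L).
Local Notation W A := (orbit_closure (limage L A) Omega).

Lemma limage_star_algebra A : A `<=` M -> star_algebra A ->
  star_algebra (limage L A).
Proof.
move=> AM sA; split.
- by move=> _ [x /AM Mx <-]; exact: lmul_bounded.
- by exists idfun; [exact: star_algebra1|exact: lmul1].
- move=> a _ _ [x Ax <-] [y Ay <-]; exists (a *: x + y).
    exact: star_algebraD.
  by rewrite lmul_linear//; exact: AM.
- move=> _ _ [x Ax <-] [y Ay <-]; exists (x \o y); first exact: star_algebraM.
  by rewrite lmulM//; exact: AM.
- move=> _ [x Ax <-]; exists (adjoint x); first exact: star_algebra_adjoint.
  by rewrite lmul_adjoint//; exact: AM.
Qed.

Lemma orbit_subspace A : A `<=` M -> star_algebra A -> linear_subspace (W A).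
Proof.
move=> AM sA; have sl := limage_star_algebra AM sA.
apply: closure_linear_subspace; split.
  by exists 0; first exact: star_algebra0.
move=> a _ _ [x Ax <-] [y Ay <-]; exists (a *: x + y) => //.
exact: star_algebraD.
Qed.

Lemma orbit_closed A : closed (W A).
Proof. exact: closed_closure. Qed.

Lemma orbitS A B : A `<=` B -> W A `<=` W B.
Proof.
move=> AB; apply: closureS => _ [_ [x /AB Bx <-] <-].
by exists (lam x) => //; exists x.
Qed.

Lemma orbit_mem A x : A x -> W A (lam x Omega).
Proof. by move=> Ax; apply: subset_closure; exists (lam x) => //; exists x. Qed.

Lemma adjoint_jones_proj A : A `<=` M -> star_algebra A ->
  adjoint (jones_proj L A) = jones_proj L A.
Proof.
by move=> AM sA; apply: adjoint_ortho_proj;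
  [exact: orbit_subspace|exact: orbit_closed].
Qed.

Lemma jones_proj_bounded A : A `<=` M -> star_algebra A ->
  bounded_op (jones_proj L A).
Proof.
by move=> AM sA; apply: ortho_proj_bounded;
  [exact: orbit_subspace|exact: orbit_closed].
Qed.

Lemma jones_proj_in A u : A `<=` M -> star_algebra A -> W A (jones_proj L A u).
Proof.
by move=> AM sA; apply: ortho_proj_in;
  [exact: orbit_subspace|exact: orbit_closed].
Qed.

Lemma jones_proj_id A u : A `<=` M -> star_algebra A -> W A u ->
  jones_proj L A u = u.
Proof.
by move=> AM sA; apply: ortho_proj_id;
  [exact: orbit_subspace|exact: orbit_closed].
Qed.

Lemma jones_proj_idem A : A `<=` M -> star_algebra A ->
  jones_proj L A \o jones_proj L A = jones_proj L A.
Proof.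
by move=> AM sA; apply/funext => u /=; rewrite jones_proj_id//;
  exact: jones_proj_in.
Qed.

Lemma jones_projS A B : A `<=` B -> B `<=` M ->
  star_algebra A -> star_algebra B ->
  jones_proj L A \o jones_proj L B = jones_proj L A /\
  jones_proj L B \o jones_proj L A = jones_proj L A.
Proof.
move=> AB BM sA sB; have AM := subset_trans AB BM.
split; apply/funext => u /=.
  by apply: ortho_proj_le; try exact: orbit_closed;
    [exact: orbit_subspace|exact: orbit_subspace|exact: orbitS].
by rewrite jones_proj_id//; apply: (orbitS AB); exact: jones_proj_in.
Qed.

Let gens_bounded A : A `<=` M -> star_algebra A ->
  limage L M `|` [set jones_proj L A] `<=` @bounded_op R L.
Proof.
move=> AM sA x [|->]; last exact: jones_proj_bounded.
move: x; apply: star_algebra_bounded.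
exact: limage_star_algebra (@subset_refl _ M) sM.
Qed.

Let gens_adjoint A : A `<=` M -> star_algebra A ->
  forall z, (limage L M `|` [set jones_proj L A]) z ->
  (limage L M `|` [set jones_proj L A]) (adjoint z).
Proof.
move=> AM sA x [Mx|->]; last by right; rewrite adjoint_jones_proj.
by left; apply: star_algebra_adjoint Mx; exact: limage_star_algebra.
Qed.

Lemma basic_construction_star_algebra A : A `<=` M -> star_algebra A ->
  star_algebra (basic_construction L A).
Proof.
move=> AM sA; apply: vN_generated_star_algebra; first exact: gens_bounded.
exact: gens_adjoint.
Qed.

Lemma limage_basic_construction A : A `<=` M -> star_algebra A ->
  limage L M `<=` basic_construction L A.
Proof.
by move=> AM sA x Mx; apply: sub_vN_generated; [exact: gens_bounded|left].
Qed.

Lemma jones_proj_basic_construction A : A `<=` M -> star_algebra A ->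
  basic_construction L A (jones_proj L A).
Proof.
by move=> AM sA; apply: sub_vN_generated; [exact: gens_bounded|right].
Qed.

(* An operator y in M' commuting with e_A leaves W B invariant, since
   y b Omega = b e_A (y Omega), and its orthogonal complement too, since
   <y u, b Omega> = <e_A y b^* u, Omega> = <y e_A b^* u, Omega>. *)
Lemma jones_proj_intermediate A B : A `<=` B -> B `<=` M ->
  star_algebra A -> star_algebra B -> basic_construction L A (jones_proj L B).
Proof.
move=> AB BM sA sB; have AM := subset_trans AB BM.
have slB := limage_star_algebra BM sB.
have sWB := orbit_subspace BM sB.
have oB u w : W B w -> inner (u - jones_proj L B u) w = 0.
  exact: ortho_proj_sub sWB (@orbit_closed B) u w.
split; first exact: jones_proj_bounded.
move=> y [[yl yc] yS]; apply/funext => u /=.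
have yM x v : M x -> y (lam x v) = lam x (y v).
  move=> Mx; have lx : limage L M (lam x) by exists x.
  by have /= -> := congr1 (@^~ v) (yS _ (or_introl lx)).
have ye v : y (jones_proj L A v) = jones_proj L A (y v).
  by have /= -> := congr1 (@^~ v) (yS _ (or_intror erefl)).
have OmA : W A Omega.
  by have := @orbit_mem A idfun (star_algebra1 sA); rewrite lmul1.
have yOm : jones_proj L A (y Omega) = y Omega.
  by rewrite -ye jones_proj_id.
have WBlam x w : B x -> W B w -> W B (lam x w).
  move=> Bx; have [_ xc] := lmul_bounded L (BM _ Bx).
  apply: (closure_preimage xc (@orbit_closed B)).
  move=> _ [_ [z Bz <-] <-] /=.
  have := @orbit_mem B (x \o z) (star_algebraM sB Bx Bz).
  by rewrite lmulM//; exact: BM.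
have yW : forall w, W B w -> W B (y w).
  apply: (closure_preimage yc (@orbit_closed B)).
  move=> _ [_ [x Bx <-] <-] /=; rewrite yM; last exact: BM.
  apply: WBlam => //; rewrite -yOm.
  by apply: (orbitS AB); exact: jones_proj_in.
have yO v : (forall w, W B w -> inner v w = 0) ->
    forall w, W B w -> inner (y v) w = 0.
  move=> vB w WBw; apply: inner_eq0C; move: w WBw.
  apply: inner_closure_eq0 => _ [_ [x Bx <-] <-].
  apply: inner_eq0C; have xb := lmul_bounded L (BM _ Bx).
  rewrite -adjointPC// -lmul_adjoint; last exact: BM.
  rewrite -yM; last by apply: BM; exact: star_algebra_adjoint.
  rewrite -(jones_proj_id AM sA OmA).
  rewrite -[inner _ _](ortho_proj_self
    (orbit_subspace AM sA) (@orbit_closed A)).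
  rewrite -[ortho_proj _ _]/(jones_proj L A _) -ye.
  (* For w in [W A], <x^* v, w> = <v, x w> vanishes because x w lies in [W B]. *)
  suff -> : jones_proj L A (lam (adjoint x) v) = 0.
    by rewrite linear_fun0// inner0l.
  rewrite /jones_proj; apply: ortho_proj_uniq => [|||w WAw];
    [exact: orbit_subspace|exact: orbit_closed|exact: (orbit_subspace AM sA).1|].
  rewrite subr0 lmul_adjoint; last exact: BM.
  rewrite adjointPC//; apply: vB; apply: WBlam => //.
  exact: (orbitS AB).
(* With e = e_B, y u splits into y (e u) in [W B] and y (u - e u) orthogonal to it; uniqueness of
   the projection gives e y = y e. *)
rewrite {1}/jones_proj; apply: ortho_proj_uniq => //.
- exact: orbit_closed.
- by apply: yW; exact: jones_proj_in.
move=> w Ww.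
rewrite -linear_funB//.
by apply: yO Ww => z; exact: oB.
Qed.

(** Only the generator e_B is at stake, and [jones_proj_intermediate] handles it. With A = N this
    places P_1 and Q_1 inside M_1. *)
Lemma basic_constructionS A B : A `<=` B -> B `<=` M ->
  star_algebra A -> star_algebra B ->
  basic_construction L B `<=` basic_construction L A.
Proof.
move=> AB BM sA sB; have AM := subset_trans AB BM.
apply: vN_generated_min => x [Mx|->]; first exact: limage_basic_construction.
exact: jones_proj_intermediate.
Qed.

Lemma inner_trace x y : M x -> M y ->
  inner (lam x Omega) (lam y Omega) = tr (adjoint y \o x).
Proof.
move=> Mx My; have My' := star_algebra_adjoint sM My.
rewrite -adjointPC; last exact: lmul_bounded.
rewrite -lmul_adjoint// -[lam _ (lam _ _)]/((lam (adjoint y) \o lam x) Omega).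
by rewrite -lmulM// trace_vectorE//; exact: star_algebraM.
Qed.

(** The squared norm of x Omega is tr (x^* x), and tr is faithful. *)
Lemma trace_vector_separating x : normalized_trace M tr -> M x ->
  lam x Omega = 0 -> x = 0.
Proof.
move=> [_ _ [_ faithful] _ _] Mx x0.
have xb := star_algebra_bounded sM Mx.
apply: adjoint_mul_eq0 => //; apply: faithful.
- by apply: star_algebraM => //; exact: star_algebra_adjoint.
- exact: op_pos_adjoint_mul.
- by rewrite -inner_trace// x0 inner0l.
Qed.

(** For a in A, tr (a^* x) = tr (E (a^* x)) = tr (a^* E x), so x Omega - E x Omega is orthogonal to
    A Omega, hence to its closure. *)
Lemma cond_exp_jones_proj A E x : A `<=` M -> star_algebra A ->
  cond_exp M tr A E -> M x -> lam (E x) Omega = jones_proj L A (lam x Omega).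
Proof.
move=> AM sA [[EA _] _ Emod _ Etr] Mx; apply/esym.
rewrite /jones_proj; apply: ortho_proj_uniq;
  [exact: orbit_subspace|exact: orbit_closed|exact/orbit_mem/EA|move=> w WAw].
apply: inner_eq0C; move: w WAw.
apply: inner_closure_eq0 => _ [_ [a Aa <-] <-]; apply: inner_eq0C.
have Ma := AM _ Aa; have MEx : M (E x) by apply: AM; exact: EA.
have Aa' := star_algebra_adjoint sA Aa.
rewrite innerBl !inner_trace// -(Etr (adjoint a \o x)); last first.
  by apply: star_algebraM => //; exact: AM.
have -> : E (adjoint a \o x) = adjoint a \o E x.
  exact: Emod _ _ idfun Aa' Mx (star_algebra1 sA).
by rewrite subrr.
Qed.

End L2Space.

(** * The angle between two projections in a tracial algebra *)

Section TwoProjections.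
Variables (R : realType) (H : hilbert R) (A : set (H -> H)).
Variable (t : (H -> H) -> R[i]).
Hypotheses (sA : star_algebra A) (tA : normalized_trace A t).
Implicit Types x y f g h : H -> H.

Lemma trace0 : t 0 = 0.
Proof.
have [tl _ _ _ _] := tA; have A0 := star_algebra0 sA.
by have := tl (-1) 0 0 A0 A0; rewrite scaler0 addr0 mulN1r addNr.
Qed.

Lemma traceZ (a : R[i]) x : A x -> t (a *: x) = a * t x.
Proof.
have [tl _ _ _ _] := tA; move=> Ax; have := tl a x 0 Ax (star_algebra0 sA).
by rewrite trace0 !addr0.
Qed.

Lemma traceB x y : A x -> A y -> t (x - y) = t x - t y.
Proof.
have [tl _ _ _ _] := tA; move=> Ax Ay; have := tl (-1) y x Ay Ax.
by rewrite scaleN1r mulN1r addrC => ->; rewrite addrC.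
Qed.

Lemma trace_adjoint_mul_ge0 x : A x -> 0 <= t (adjoint x \o x).
Proof.
have [_ _ [tpos _] _ _] := tA; move=> Ax; apply: tpos.
  by apply: star_algebraM => //; exact: star_algebra_adjoint.
exact: op_pos_adjoint_mul (star_algebra_bounded sA Ax).
Qed.

Lemma trace_adjoint_mul_eq0 x : A x -> t (adjoint x \o x) = 0 -> x = 0.
Proof.
have [_ _ [_ tfaith] _ _] := tA; move=> Ax tx0.
have xb := star_algebra_bounded sA Ax.
apply: adjoint_mul_eq0 => //; apply: tfaith => //.
  by apply: star_algebraM => //; exact: star_algebra_adjoint.
exact: op_pos_adjoint_mul.
Qed.

Definition projection f := A f /\ adjoint f = f /\ f \o f = f.

(** Here (g f)^* (g f) = f g f, and traciality brings the two factors f together. *)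
Lemma inner2_projections f g : projection f -> projection g ->
  inner2 t f g = t (adjoint (g \o f) \o (g \o f)).
Proof.
move=> [Af [fa ff]] [Ag [ga gg]]; have [_ tC _ _ _] := tA.
have [fb gb] := (star_algebra_bounded sA Af, star_algebra_bounded sA Ag).
rewrite /inner2 ga adjointM// fa ga.
have -> : (f \o g) \o (g \o f) = f \o (g \o f).
  by rewrite -compA [g \o (g \o f)]compA gg.
rewrite [RHS]tC//; last exact: star_algebraM.
by rewrite -compA ff.
Qed.

Lemma inner2_self f : projection f -> inner2 t f f = t f.
Proof. by move=> [_ [fa ff]]; rewrite /inner2 fa ff. Qed.

Lemma inner2_projections_ge0 f g : projection f -> projection g ->
  0 <= inner2 t f g.
Proof.
move=> pf pg; rewrite inner2_projections//.
apply: trace_adjoint_mul_ge0.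
by apply: star_algebraM => //; [case: pg|case: pf].
Qed.

Lemma inner2_projections_eq0 f g : projection f -> projection g ->
  inner2 t f g = 0 <-> g \o f = 0.
Proof.
move=> pf pg; split=> [|gf0].
  rewrite inner2_projections//; apply: trace_adjoint_mul_eq0.
  by apply: star_algebraM => //; [case: pg|case: pf].
by rewrite /inner2; have [_ [-> _]] := pg; rewrite gf0 trace0.
Qed.

Lemma projection_compl f : projection f -> projection (idfun - f).
Proof.
move=> [Af [fa ff]]; have fb := star_algebra_bounded sA Af.
have [fl _] := fb.
split; first exact: star_algebraB (star_algebra1 sA) Af.
split.
  rewrite adjointB ?fa//; last exact: bounded_op1.
  by congr (_ - _); apply: adjoint_uniq.
apply/funext => u.
have fE : f (f u) = f u by have /= := congr1 (@^~ u) ff.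
change ((u - f u) - f (u - f u) = u - f u).
by rewrite linear_funB// fE subrr subr0.
Qed.

(* t(gf) = t(f) - t((1 - g) f), and the last term is nonnegative. *)
Lemma inner2_projections_le f g : projection f -> projection g ->
  inner2 t f g <= t f.
Proof.
move=> pf pg; have := inner2_projections_ge0 pf (projection_compl pg).
have [Af [fa ff]] := pf; have [Ag [ga gg]] := pg.
rewrite /inner2; have [_ [-> _]] := projection_compl pg.
have -> : (idfun - g) \o f = f - (g \o f) by [].
rewrite ga traceB//; last exact: star_algebraM.
by rewrite subr_ge0.
Qed.

Lemma inner2C_projections f g : projection f -> projection g ->
  inner2 t f g = inner2 t g f.
Proof.
move=> [Af [fa _]] [Ag [ga _]]; have [_ tC _ _ _] := tA.
by rewrite /inner2 ga fa tC.
Qed.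

Lemma norm2_projection_eq0 f : projection f -> norm2 t f = 0 -> f = 0.
Proof.
move=> pf /eqP; rewrite sqrtC_eq0 => /eqP.
by move=> /(inner2_projections_eq0 pf pf).1; case: pf => _ [_ ->].
Qed.

(** At f = e_P - e_N this unfolds to [unit_proj]. *)
Definition normalized f := (norm2 t f)^-1 *: f.

Lemma inner2_normalized f g : projection f -> projection g ->
  inner2 t (normalized f) (normalized g) =
  (norm2 t f)^-1 * (norm2 t g)^-1 * inner2 t f g.
Proof.
move=> [Af _] [Ag _]; have gb := star_algebra_bounded sA Ag.
rewrite /inner2 /normalized adjointZ//.
have ng : Num.conj (norm2 t g)^-1 = (norm2 t g)^-1.
  apply: CrealP; rewrite realV ger0_real// sqrtC_ge0.
  exact: trace_adjoint_mul_ge0.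
rewrite ng.
set a := (norm2 t f)^-1; set b := (norm2 t g)^-1.
have [gl _] := adjoint_bounded gb.
have -> : (b *: adjoint g) \o (a *: f) = (a * b) *: (adjoint g \o f).
  apply/funext => u; change (b *: adjoint g (a *: f u) =
    (a * b) *: adjoint g (f u)).
  by rewrite -[a *: f u]addr0 gl linear_fun0// addr0 scalerA mulrC.
by rewrite traceZ//; apply: star_algebraM => //; exact: star_algebra_adjoint.
Qed.

Lemma acos_inner2_normalized f g : projection f -> projection g ->
  acos (complex.Re (inner2 t (normalized f) (normalized g))) = pi / 2%:R <->
  g \o f = 0.
Proof.
move=> pf pg; rewrite inner2_normalized//.
have [f0|nf] := eqVneq (norm2 t f) 0.
  rewrite f0 invr0 !mul0r acos0; split=> // _.
  rewrite (norm2_projection_eq0 pf f0); apply/funext => u /=.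
  by apply: linear_fun0; have [/(star_algebra_bounded sA)[]] := pg.
have [g0|ng] := eqVneq (norm2 t g) 0.
  rewrite g0 invr0 mulr0 mul0r acos0; split=> // _.
  by rewrite (norm2_projection_eq0 pg g0).
set c := _ * _.
have nge0 h : projection h -> 0 <= norm2 t h.
  by move=> ph; rewrite sqrtC_ge0 inner2_projections_ge0.
have sqn h : projection h -> norm2 t h ^+ 2 = t h.
  by move=> ph; rewrite sqrtCK inner2_self.
have c0 : 0 <= c.
  by rewrite !mulr_ge0 ?invr_ge0 ?nge0// inner2_projections_ge0.
(* Squaring removes the roots: t(gf)^2 <= t(f) t(g) is the product of t(gf) <= t(f) and t(gf) <=
   t(g). *)
have c1 : c <= 1.
  rewrite -(ler_pXn2r (_ : 0 < 2)%N) ?nnegrE ?ler01// expr1n.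
  rewrite !exprMn !exprVn !sqn//.
  have tf : 0 < t f by rewrite -sqn// exprn_gt0// lt0r nf nge0.
  have tg : 0 < t g by rewrite -sqn// exprn_gt0// lt0r ng nge0.
  rewrite -invfM mulrC ler_pdivrMr ?mulr_gt0// mul1r expr2.
  apply: ler_pM; rewrite ?inner2_projections_ge0 ?inner2_projections_le//.
  by rewrite inner2C_projections// inner2_projections_le.
(* A nonnegative element of R[i] is real, so [c0] makes the real part harmless. *)
have cE : (complex.Re c)%:C = c by rewrite RRe_real// ger0_real.
have cgf : complex.Re c = 0 <-> g \o f = 0.
  rewrite -inner2_projections_eq0//; split=> [Rc|i0]; last first.
    by rewrite /c i0 mulr0.
  move: cE; rewrite Rc => /esym/eqP.
  by rewrite !mulf_eq0 !invr_eq0 (negPf nf) (negPf ng) => /eqP.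
have cb : -1 <= complex.Re c <= 1.
  by rewrite -!lecR cE c1 andbT (le_trans _ c0)// lecR lerN10.
rewrite -cgf; split=> [ac|->]; last exact: acos0.
rewrite -[complex.Re c](@acosK R); last by rewrite in_itv.
by rewrite ac cos_pihalf.
Qed.

End TwoProjections.

(** * Commuting squares read off from Jones projections *)

Section CommutingSquare.
Variables (R : realType) (K : hilbert R) (M : set (K -> K)).
Variables (tr : (K -> K) -> R[i]) (L : L2_space M tr).
Hypotheses (sM : star_algebra M) (htr : normalized_trace M tr).
Variables N P Q : set (K -> K).
Hypotheses (NP : N `<=` P) (PM : P `<=` M) (QM : Q `<=` M).
Hypotheses (sN : star_algebra N) (sP : star_algebra P) (sQ : star_algebra Q).

Local Notation lam := (@lmul R K M tr L).
Local Notation Omega := (trace_vector L).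

Let NM : N `<=` M := subset_trans NP PM.

(** From expectations to projections, equality on M Omega extends by density (Omega is cyclic); the
    converse uses that Omega is separating. *)
Lemma commuting_square_jones_proj (E : set (K -> K) -> (K -> K) -> (K -> K)) :
  cond_exp M tr N (E N) -> cond_exp M tr P (E P) -> cond_exp M tr Q (E Q) ->
  commuting_square E N P Q M <->
  jones_proj L P \o jones_proj L Q = jones_proj L N.
Proof.
move=> hN hP hQ.
have EP x : M x -> P (E P x) by have [[EP _] _ _ _ _] := hP; exact: EP.
have EQ x : M x -> Q (E Q x) by have [[EQ _] _ _ _ _] := hQ; exact: EQ.
have EN x : M x -> N (E N x) by have [[EN _] _ _ _ _] := hN; exact: EN.
have MP x : M x -> M (E P x) by move=> Mx; apply/PM/EP.
have MQ x : M x -> M (E Q x) by move=> Mx; apply/QM/EQ.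
have MN x : M x -> M (E N x) by move=> Mx; apply/NM/EN.
have PQE x : M x -> lam (E P (E Q x)) Omega =
    jones_proj L P (jones_proj L Q (lam x Omega)).
  move=> Mx; rewrite (cond_exp_jones_proj L sM PM sP hP); last exact: MQ.
  by rewrite (cond_exp_jones_proj L sM QM sQ hQ).
have QPE x : M x -> lam (E Q (E P x)) Omega =
    jones_proj L Q (jones_proj L P (lam x Omega)).
  move=> Mx; rewrite (cond_exp_jones_proj L sM QM sQ hQ); last exact: MP.
  by rewrite (cond_exp_jones_proj L sM PM sP hP).
have NE := cond_exp_jones_proj L sM NM sN hN.
have Pb := jones_proj_bounded L PM sP.
have Qb := jones_proj_bounded L QM sQ.
have Nb := jones_proj_bounded L NM sN.
split=> [sq|eq].
  apply/funext => u.
  have [_ PQc] := bounded_opM Pb Qb; have [_ Nc] := Nb.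
  apply: (closure_eq PQc Nc (A := [set x Omega | x in limage L M])).
    by move=> _ [_ [x Mx <-] <-]; rewrite /= -PQE// -NE// (sq _ Mx).1.
  by rewrite -[closure _]/(orbit_closure _ _) trace_vector_cyclic.
(* The square demands both orders of composition; the second identity is the adjoint of the
   first. *)
have eq' : jones_proj L Q \o jones_proj L P = jones_proj L N.
  rewrite -(adjoint_jones_proj L NM sN) -eq adjointM//.
  by rewrite !adjoint_jones_proj.
have inj x y : M x -> M y -> lam x Omega = lam y Omega -> x = y.
  move=> Mx My xy; apply/subr0_eq/(trace_vector_separating (L := L) sM htr).
    exact: star_algebraB.
  rewrite addrC -scaleN1r lmul_linear//.
  change (-1 *: lam y Omega + lam x Omega = 0).
  by rewrite xy scaleN1r addNr.
move=> x Mx; split; apply: inj; try exact: MN.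
- exact/MP/MQ.
- by rewrite PQE// NE//; have /= -> := congr1 (@^~ (lam x Omega)) eq.
- exact/MQ/MP.
- by rewrite QPE// NE//; have /= -> := congr1 (@^~ (lam x Omega)) eq'.
Qed.

End CommutingSquare.

(** In the expansion, f e, e g and e e all equal e. It serves both for idempotence of e_P - e_N and
    for g f in the theorem. *)
Lemma compBB (R : realType) (H : hilbert R) (f g e : H -> H) :
  linear f -> linear e -> f \o e = e -> e \o g = e -> e \o e = e ->
  (f - e) \o (g - e) = (f \o g) - e.
Proof.
move=> fl el fe eg ee; apply/funext => u.
change (f (g u - e u) - e (g u - e u) = f (g u) - e u).
have /= feu := congr1 (@^~ u) fe; have /= egu := congr1 (@^~ u) eg.
have /= eeu := congr1 (@^~ u) ee.
by rewrite (linear_funB _ _ fl) (linear_funB _ _ el) feu egu eeu subrr subr0.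
Qed.

(** e_N lies below e_P, so the difference is a projection; [jones_proj_intermediate] is what puts it
    in the algebra carrying the trace. *)
Lemma jones_projB_projection (R : realType) (K : hilbert R)
    (M : set (K -> K)) (tr : (K -> K) -> R[i]) (L : L2_space M tr)
    (N P : set (K -> K)) :
  star_algebra M -> star_algebra N -> star_algebra P ->
  N `<=` P -> P `<=` M ->
  projection (basic_construction L N) (jones_proj L P - jones_proj L N).
Proof.
move=> sM sN sP NP PM; have NM := subset_trans NP PM.
have sB := basic_construction_star_algebra L sM NM sN.
have BP : basic_construction L N (jones_proj L P).
  exact: jones_proj_intermediate.
have BN : basic_construction L N (jones_proj L N).
  exact: jones_proj_basic_construction.
have [NPe PNe] := jones_projS L NP PM sN sP.
have [[Pl _] [Nl _]] :=
  (jones_proj_bounded L PM sP, jones_proj_bounded L NM sN).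
split; first exact: star_algebraB.
split.
  rewrite adjointB; [|exact: jones_proj_bounded..].
  by rewrite !adjoint_jones_proj.
by rewrite compBB ?jones_proj_idem.
Qed.

Theorem proposition3p7
  (R : realType) (K : hilbert R) (N P Q M : set (K -> K))
  (hN : II1_factor N) (hP : II1_factor P) (hQ : II1_factor Q)
  (hM : II1_factor M)
  (hNP : N `<=` P) (hNQ : N `<=` Q) (hPM : P `<=` M) (hQM : Q `<=` M)
  (hP_neq : P <> M) (hQ_neq : Q <> M)
  (* tr is the trace of M, L is L^2(M) *)
  (tr : (K -> K) -> R[i]) (htr : normalized_trace M tr)
  (L : L2_space M tr) (hindex : finite_index L N)
  (* tr1 is the trace of M_1, L1 is L^2(M_1) *)
  (tr1 : (L -> L) -> R[i])
  (htr1 : normalized_trace (basic_construction L N) tr1)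
  (L1 : L2_space (basic_construction L N) tr1)
  (* tr2 is the trace of the basic construction of M in M_1 *)
  (tr2 : (L1 -> L1) -> R[i])
  (htr2 : normalized_trace (basic_construction L1 (limage L M)) tr2)
  (* E A is the conditional expectation of M_1 onto A, for A = M, P_1, Q_1 *)
  (E : set (L -> L) -> (L -> L) -> (L -> L))
  (hEM : cond_exp (basic_construction L N) tr1 (limage L M) (E (limage L M)))
  (hEP1 : cond_exp (basic_construction L N) tr1
    (basic_construction L P) (E (basic_construction L P)))
  (hEQ1 : cond_exp (basic_construction L N) tr1
    (basic_construction L Q) (E (basic_construction L Q))) :
  co_commuting_square L E N P Q <->
  dual_angle tr2 P Q = pi / 2%:R.
Proof.
have star (A : set (K -> K)) : II1_factor A -> star_algebra A.
  by case=> [[/von_neumann_star_algebra]].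
have [sN sP sQ sM] := And4 (star _ hN) (star _ hP) (star _ hQ) (star _ hM).
have NM := subset_trans hNP hPM.
have sM1 := basic_construction_star_algebra L sM NM sN.
have sP1 := basic_construction_star_algebra L sM hPM sP.
have sQ1 := basic_construction_star_algebra L sM hQM sQ.
have slM := limage_star_algebra L (@subset_refl _ M) sM.
have MP1 := limage_basic_construction (L := L) sM hPM sP.
have MQ1 := limage_basic_construction (L := L) sM hQM sQ.
have PM1 := basic_constructionS (L := L) sM hNP hPM sN sP.
have QM1 := basic_constructionS (L := L) sM hNQ hQM sN sQ.
have MM1 := subset_trans MP1 PM1.
(* From here on the ambient algebra is M_1 acting on L^2(M_1), with the image of M as the small
   algebra. *)
have sM2 := basic_construction_star_algebra L1 sM1 MM1 slM.
have [QMe MQe] := jones_projS L1 MQ1 QM1 slM sQ1.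
have [PMe MPe] := jones_projS L1 MP1 PM1 slM sP1.
have [[Ql _] [Ml _]] :=
  (jones_proj_bounded L1 QM1 sQ1, jones_proj_bounded L1 MM1 slM).
rewrite /co_commuting_square (commuting_square_jones_proj L1 sM1 htr1)//.
rewrite /dual_angle /angle.
(* Taking f from P_1 and g from Q_1 yields e_Q1 e_P1, the order in which [co_commuting_square] lists
   Q_1 and P_1. *)
have := acos_inner2_normalized sM2 htr2
  (jones_projB_projection L1 sM1 slM sP1 MP1 PM1)
  (jones_projB_projection L1 sM1 slM sQ1 MQ1 QM1).
move=> ->; rewrite compBB ?jones_proj_idem//.
by split=> [->|/subr0_eq//]; rewrite subrr.
Qed.
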